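(* Let $$A=\sqrt{\tfrac23}\begin{bmatrix}1&-\tfrac12&-\tfrac12&0\\0&\tfrac{\sqrt3}2&-\tfrac{\sqrt3}2&0\end{bmatrix},\qquad c=\begin{bmatrix}0&1&0&0\\0&0&1&0\\0&0&0&1\\1&0&0&0\end{bmatrix},$$ let $c_k=c^k$ for $k\in\{0,1,2,3\}$, and let $d_0=I_4$, $d_1=\mathrm{diag}(1,1,-1,-1)$, $d_2=\mathrm{diag}(1,-1,1,-1)$, $d_3=\mathrm{diag}(1,-1,-1,1)$. For $j,k\in\{0,1,2,3\}$ put $A_{j,k}=A\,d_j\,c_k$ and $P_{j,k}=A_{j,k}^*A_{j,k}$. Then: (a) $\mathcal P=\{P_{j,k}\}_{j,k\in\{0,1,2,3\}}$ is a real tight $(16,2,4)$-fusion frame which is chordally biangular, with chordal fusion frame angle set $\Theta_{\mathcal P}=\{\sqrt{10/9},\sqrt{2/3}\}$. (b) The Plücker embeddings of the elements of $\mathcal P$, computed with the generators $A_{j,k}$, i.e. the $16$ vectors $\Phi(A_{j,k})\in\mathbb R^6$, $j,k\in\{0,1,2,3\}$ (grouped into consecutive blocks according to $k$), form a Steiner ETF of $16$ vectors for $\mathbb R^6$.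
   Context: A real tight $(n,l,m)$-fusion frame is a set $\{P_j\}_{j=1}^n$ of $m\times m$ real orthogonal projection matrices of rank $l$ with $\sum_{j=1}^nP_j=aI_m$ for some $a>0$. Its chordal fusion frame angle set is $\{\sqrt{\mathrm{tr}(P_jP_{j'})} : j\ne j'\}$, and it is chordally biangular if this set has exactly two elements. For a real $2\times4$ matrix $B=[b_1\,b_2\,b_3\,b_4]$ with $BB^*=I_2$, the Plücker embedding is $\Phi(B)=(\det[b_1\,b_2],\det[b_1\,b_3],\det[b_1\,b_4],\det[b_2\,b_3],\det[b_2\,b_4],\det[b_3\,b_4])\in\mathbb R^6$. A generator of a rank-2 orthogonal projection $P$ on $\mathbb R^4$ is such a $B$ with $P=B^*B$. Generators of $P$ are unique up to left multiplication by an orthogonal $2\times 2$ matrix $U$; $\Phi(B)$ is unchanged when $\det U=1$, and for each $P_{j,k}$ the chosen generator is $A_{j,k}$. An $(n,m)$-frame for $\mathbb R^m$ is a family of $n$ unit vectors whose synthesis matrix $F$ (the matrix with these vectors as columns) satisfies $FF^*=aI_m$ for some $a>0$; it is an equiangular tight frame (ETF) if $|\langle f_j,f_{j'}\rangle|$ takes exactly one value over all $j\neq j'$; it is flat if every entry of $F$ has absolute value $1/\sqrt m$. A $(v,k)$-Steiner matrix is a $\{0,1\}$-matrix of size $\frac{v(v-1)}{k(k-1)}\times v$ with exactly $k$ ones in each row, exactly $s=\frac{v-1}{k-1}$ ones in each column, and with any two distinct columns having dot product one. A Steiner ETF is an ETF whose synthesis matrix has the form $F=[F_1\,\cdots\,F_v]$,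 where, for some $(v,k)$-Steiner matrix $S$ and synthesis matrices $H_1,\dots,H_v$ of flat equiangular $(s+1,s)$-frames, $F_j$ is obtained by replacing each one in the $j$th column of $S$ with a distinct row of $H_j$ and each zero with a row of $s+1$ zeros. *)

(* Defs.v *)
From HB Require Import structures.
From mathcomp Require Import all_boot all_order all_algebra.
From mathcomp Require Import boolp classical_sets reals.
Set Implicit Arguments.
Unset Strict Implicit.
Unset Printing Implicit Defensive.
Import Order.TTheory GRing.Theory Num.Theory.
Local Open Scope classical_set_scope.
Local Open Scope ring_scope.

Definition orthogonal_projection (R : realType) (m : nat) (P : 'M[R]_m) : Prop :=
  P *m P = P /\ P^T = P.

(* The n members of the frame are indexed by an arbitrary finite type with n
   elements; they form a set of n projections, so they are distinct. *)
Definition tight_fusion_frame (R : realType) (n l m : nat) (I : finType)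
    (P : I -> 'M[R]_m) : Prop :=
  [/\ #|I| = n,
      injective P,
      (forall i, orthogonal_projection (P i) /\ \rank (P i) = l)
    & exists2 a : R, 0 < a & \sum_i P i = a%:M].

Definition chordal_angle_set (R : realType) (m : nat) (I : finType)
    (P : I -> 'M[R]_m) : set R :=
  [set t | exists i j, i != j /\ t = Num.sqrt (\tr (P i *m P j))].

Definition chordally_biangular (R : realType) (m : nat) (I : finType)
    (P : I -> 'M[R]_m) : Prop :=
  exists a b : R, a != b /\ chordal_angle_set P = [set a; b].

Definition is_generator (R : realType) (P : 'M[R]_4) (B : 'M[R]_(2, 4)) : Prop :=
  B *m B^T = 1%:M /\ P = B^T *m B.

Definition plucker_minor (R : realType) (B : 'M[R]_(2, 4)) (a b : nat) : R :=
  \det (row_mx (col (inord a) B) (col (inord b) B)).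

Definition plucker (R : realType) (B : 'M[R]_(2, 4)) : 'cV[R]_6 :=
  let: p := plucker_minor B in
  \col_(i < 6) [:: p 0 1; p 0 2; p 0 3; p 1 2; p 1 3; p 2 3]%N`_i.

(* Frames are represented by their synthesis matrices: the frame vectors are
   the columns of F, and (F^T *m F) i j is the inner product of the i-th and
   j-th ones. *)
Definition unit_tight_frame (R : realType) (m n : nat) (F : 'M[R]_(m, n)) : Prop :=
  (forall j, (F^T *m F) j j = 1) /\
  (exists2 a : R, 0 < a & F *m F^T = a%:M).

Definition frame_angle_set (R : realType) (m n : nat) (F : 'M[R]_(m, n)) : set R :=
  [set t | exists i j, i != j /\ t = `|(F^T *m F) i j|].

Definition etf (R : realType) (m n : nat) (F : 'M[R]_(m, n)) : Prop :=
  unit_tight_frame F /\ exists t : R, frame_angle_set F = [set t].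

Definition flat (R : realType) (m n : nat) (F : 'M[R]_(m, n)) : Prop :=
  forall i j, `|F i j| = 1 / Num.sqrt m%:R.

(* The first two equations say b = v(v-1)/(k(k-1)) and s = (v-1)/(k-1) without
   truncated division. *)
Definition steiner_matrix (v k b s : nat) (S : 'M[nat]_(b, v)) : Prop :=
  [/\ (1 < k)%N,
      (b * (k * (k - 1)) = v * (v - 1))%N /\ (s * (k - 1) = v - 1)%N,
      (forall i j, S i j = 0%N \/ S i j = 1%N),
      (forall i, (\sum_j S i j)%N = k) /\ (forall j, (\sum_i S i j)%N = s)
    & forall j j', j != j' -> (\sum_i S i j * S i j')%N = 1%N].

(* r selects, for each one in the j-th column of S, the row of H replacing it;
   its value at the zeros of that column is irrelevant. *)
Definition steiner_block (R : realType) (v b s : nat) (S : 'M[nat]_(b, v))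
    (j : 'I_v) (H : 'M[R]_(s, s.+1)) (Fj : 'M[R]_(b, s.+1)) : Prop :=
  exists r : 'I_b -> 'I_s,
    (forall i i', S i j = 1%N -> S i' j = 1%N -> r i = r i' -> i = i') /\
    (forall i, row i Fj = if S i j == 1%N then row (r i) H else 0).

Definition steiner_etf (R : realType) (m n : nat) (F : 'M[R]_(m, n)) : Prop :=
  etf F /\
  exists (v k s : nat) (S : 'M[nat]_(m, v)) (H : 'I_v -> 'M[R]_(s, s.+1))
         (Fb : 'I_v -> 'M[R]_(m, s.+1)) (en : (\sum_(j < v) s.+1)%N = n),
    [/\ steiner_matrix k s S,
        (forall j, etf (H j) /\ flat (H j)),
        (forall j, steiner_block S j (H j) (Fb j))
      & F = castmx (erefl m, en) (\mxrow_(j < v) Fb j)].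

Definition mx_of_rows (R : realType) (m n : nat) (rows : seq (seq R)) : 'M[R]_(m, n) :=
  \matrix_(i < m, j < n) (nth [::] rows i)`_j.

Definition diag4 (R : realType) (x : seq R) : 'M[R]_4 :=
  diag_mx (\row_(j < 4) x`_j).

Definition A0 (R : realType) : 'M[R]_(2, 4) :=
  Num.sqrt (2 / 3) *:
  mx_of_rows 2 4
    [:: [:: 1; - (1 / 2);        - (1 / 2);          0];
        [:: 0; Num.sqrt 3 / 2;   - (Num.sqrt 3 / 2); 0]].

Definition cmx (R : realType) : 'M[R]_4 :=
  mx_of_rows 4 4
    [:: [:: 0; 1; 0; 0];
        [:: 0; 0; 1; 0];
        [:: 0; 0; 0; 1];
        [:: 1; 0; 0; 0]].

Definition dmx (R : realType) (j : nat) : 'M[R]_4 :=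
  [:: 1%:M;
      diag4 [:: 1;  1; -1; -1];
      diag4 [:: 1; -1;  1; -1];
      diag4 [:: 1; -1; -1;  1]]`_j.

Definition Agen (R : realType) (j k : nat) : 'M[R]_(2, 4) :=
  A0 R *m dmx R j *m (cmx R ^+ k).

Definition Pproj (R : realType) (j k : nat) : 'M[R]_4 :=
  (Agen R j k)^T *m Agen R j k.

(* Main.v *)
Require Import Defs.
From HB Require Import structures.
From mathcomp Require Import all_boot all_order all_algebra.
From mathcomp Require Import ring lra zify.
From mathcomp Require Import boolp classical_sets reals.
Set Implicit Arguments.
Unset Strict Implicit.
Unset Printing Implicit Defensive.
Import Order.TTheory GRing.Theory Num.Theory.
Local Open Scope classical_set_scope.
Local Open Scope ring_scope.

(** The rows of [A0] are orthonormal and orthogonal to the last coordinate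
    vector and to (1,1,1,0), so [A0^T *m A0] is the projection of the coordinate
    space of the first three axes onto the complement of (1,1,1).  Multiplying
    by a diagonal sign matrix and a power of the cyclic shift replaces (1,1,1,0)
    by a vector [w] with one zero, at a position depending on [k] only, and
    three signs, which up to the shift depend on [j] only.  Thus [Pproj j k = D - w w^T / 3]
    with [D] the diagonal matrix of the squares of [w] ([PprojE]), and a
    [2 x 2] minor of [Agen j k] on columns [a], [b] is
    [+- w_a w_b / sqrt 3] ([plucker_Agen]).  All irrational factors therefore
    separate: [3 * Pproj] and [sqrt 3 * plucker] are integer tables.

    For part (a), two supports of size three coincide or meet in two positions;
    then [tr (P P')] is [1 + (w,w')^2 / 9] with [(w,w') = +-1], respectively
    [2/3 + (w,w')^2 / 9] with [(w,w')] in [{0, 2, -2}], so it is [10/9] or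
    [2/3] ([trace_Pproj_val]).  As [tr (P P) = 2], the sixteen projections are
    distinct.  For fixed [k] the four sign patterns average [w w^T] to [D], and
    the four [D] sum to [3 I], so the projections sum to [8 I] ([Pproj_sum]).

    For part (b), the coordinates of the Pluecker vectors are the edges of the
    complete graph on four points, and the vectors with a given [k] are
    supported on the triangle avoiding one point.  Two triangles share exactly
    one edge, so the edge-triangle incidence matrix is a (4,2)-Steiner matrix
    ([steinerS_steiner]).  Restricted to its triangle, a block of four Pluecker
    vectors is a [3 x 4] sign matrix over [sqrt 3] with orthogonal rows, which
    is a flat simplex frame ([flat_etf]); the Steiner construction then returns
    the given vectors ([synth_steiner]).  The finitely many integer identities
    that remain are evaluated. *)

(** * Integer matrices over the square root of three *)

(** A sum over ordinals in a form that the kernel can evaluate, unlike the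
    locked big operators. *)
Definition isum (n : nat) (F : nat -> int) : int :=
  foldr (fun i s => F i + s) 0 (iota 0 n).

Lemma isumE (R : realType) n (F : nat -> int) :
  \sum_(i < n) (F i)%:~R = (isum n F)%:~R :> R.
Proof.
rewrite -(big_mkord xpredT (fun i => (F i)%:~R)) -rmorph_sum /=; congr (_%:~R).
by rewrite unlock /isum /index_iota subn0; elim: iota => //= i s ->.
Qed.

Lemma all_ord n (p : pred nat) : all p (iota 0 n) -> forall i : 'I_n, p i.
Proof. by move=> /allP h i; apply: h; rewrite mem_iota ltn_ord. Qed.

Lemma all2_ord m n (p : nat -> nat -> bool) :
  all (fun i => all (p i) (iota 0 n)) (iota 0 m) ->
  forall (i : 'I_m) (j : 'I_n), p i j.
Proof. by move=> h i; apply: all_ord; exact: (all_ord h). Qed.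

(** Both the large frame and the flat frames it is built from have all their
    entries in [{0, 1, -1}] divided by [sqrt 3]. *)
Definition scaled_mx (R : realType) m n (N : nat -> nat -> int) : 'M[R]_(m, n) :=
  \matrix_(i, t) ((N i t)%:~R / Num.sqrt 3).

Lemma sqrt3_gt0 (R : realType) : 0 < Num.sqrt 3 :> R.
Proof. by rewrite sqrtr_gt0. Qed.

Lemma sqrt3_sq (R : realType) : Num.sqrt 3 * Num.sqrt 3 = 3 :> R.
Proof. by rewrite -expr2 sqr_sqrtr. Qed.

Lemma div_sqrt3_mul (R : realType) (x y : R) :
  x / Num.sqrt 3 * (y / Num.sqrt 3) = x * y / 3.
Proof.
have := sqrt3_gt0 R; move=> /lt0r_neq0 h.
by rewrite mulrACA -invfM sqrt3_sq.
Qed.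

Lemma scaled_gram (R : realType) m n (N : nat -> nat -> int) t t' :
  ((scaled_mx R m n N)^T *m scaled_mx R m n N) t t' =
  (isum m (fun i => N i t * N i t'))%:~R / 3.
Proof.
rewrite -isumE !mxE big_distrl /=; apply: eq_bigr => i _.
by rewrite !mxE div_sqrt3_mul intrM.
Qed.

Lemma scaled_cogram (R : realType) m n (N : nat -> nat -> int) i i' :
  (scaled_mx R m n N *m (scaled_mx R m n N)^T) i i' =
  (isum n (fun t => N i t * N i' t))%:~R / 3.
Proof.
rewrite -isumE !mxE big_distrl /=; apply: eq_bigr => t _.
by rewrite !mxE div_sqrt3_mul intrM.
Qed.

(** After scaling, the columns of squared norm 3 become unit vectors, and the
    products [+-1] of distinct columns become inner products [+-1/3]: both frames
    have the common angle 1/3, with frame bound [c/3]. *)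
Lemma etf_scaled (R : realType) m n (N : nat -> nat -> int) (c : nat) :
  (0 < c)%N -> (1 < n)%N ->
  all (fun t => all (fun t' =>
    let x := isum m (fun i => N i t * N i t') in
    if t == t' then x == 3 else `|x| == 1) (iota 0 n)) (iota 0 n) ->
  all (fun i => all (fun i' =>
    isum n (fun t => N i t * N i' t) == (if i == i' then c else 0%N))
    (iota 0 m)) (iota 0 m) ->
  etf (scaled_mx R m n N).
Proof.
move=> c0 n1 /all2_ord gr /all2_ord cogr.
have off i j : i != j ->
    `|((scaled_mx R m n N)^T *m scaled_mx R m n N) i j| = 1 / 3.
  move=> ij; rewrite scaled_gram normrM normfV -intr_norm [`|3|]ger0_norm //.
  by have := gr i j; rewrite /= (inj_eq val_inj) (negbTE ij) => /eqP ->.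
split; first split.
- move=> j; rewrite scaled_gram; have /= := gr j j.
  by rewrite eqxx => /eqP ->; rewrite divff // pnatr_eq0.
- exists (c%:R / 3); first by rewrite divr_gt0 // ltr0n.
  apply/matrixP => i i'; rewrite scaled_cogram (eqP (cogr i i')) mxE.
  by rewrite (inj_eq val_inj); case: eqP => // _; rewrite mul0r.
- exists (1 / 3); apply/seteqP; split=> t /=.
    by case=> i [j [ij ->]]; rewrite off.
  move=> ->; exists (Ordinal (ltnW n1)), (Ordinal n1); split=> //.
  by rewrite off.
Qed.

(** * Entries of the generators *)

(** The column of [A0] that right multiplication by the [k]-th power of the
    cyclic shift moves to position [a]; [3 * k] stands for [- k] modulo 4. *)
Definition src_col (k a : nat) : nat := (a + 3 * k) %% 4.

Definition dmx_sign (j x : nat) : int :=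
  nth 0 (nth [::] [:: [:: 1; 1; 1; 1]; [:: 1; 1; -1; -1];
                      [:: 1; -1; 1; -1]; [:: 1; -1; -1; 1]] j) x.

(** The vector [w]: a signed and shifted copy of (1,1,1,0), whose entries vanish
    where the generator has its zero column. *)
Definition sign_row (j k a : nat) : int :=
  if (src_col k a < 3)%N then dmx_sign j (src_col k a) else 0.

(** The shift sends the [x]-th basis row vector to the next one, so its powers
    are the rotations. *)
Lemma cmxXE (R : realType) k (x a : 'I_4) :
  (cmx R ^+ k) x a = ((x + k) %% 4 == a)%N%:R.
Proof.
elim: k x => [|k IH] x.
  by rewrite expr0 mxE addn0 (modn_small (ltn_ord x)).
rewrite exprS mxE (bigD1 (ordS x)) //= big1 => [|y yx].
  rewrite IH mxE addr0 /= modnDml addSnnS.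
  by case: x => [[|[|[|[|?]]]] ?] //=; rewrite mul1r.
rewrite mxE; move: yx; rewrite -(inj_eq val_inj) /=.
by case: x => [[|[|[|[|?]]]] ?]; case: y => [[|[|[|[|?]]]] ?] //=; rewrite mul0r.
Qed.

Lemma dmxE (R : realType) (j x y : 'I_4) :
  dmx R j x y = (dmx_sign j x)%:~R *+ (x == y).
Proof.
rewrite /dmx /diag4.
case: j => [[|[|[|[|?]]]] ?] //=; rewrite !mxE //;
by case: x => [[|[|[|[|?]]]] ?] //=.
Qed.

Lemma AgenE (R : realType) (j : 'I_4) k r (a : 'I_4) :
  Agen R j k r a =
  A0 R r (inord (src_col k a)) * (dmx_sign j (src_col k a))%:~R.
Proof.
have sh4 : (src_col k a < 4)%N by rewrite ltn_mod.
rewrite /Agen mxE (bigD1 (inord (src_col k a))) //= big1 ?addr0 => [|x xa].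
  rewrite cmxXE inordK // /src_col modnDml.
  have -> : ((a + 3 * k + k) %% 4 == a)%N by have := ltn_ord a; lia.
  rewrite mulr1 mxE (bigD1 (inord (src_col k a))) //= big1 ?addr0 => [|x xa].
    by rewrite dmxE inordK // eqxx.
  by rewrite dmxE (negbTE xa) mulr0.
rewrite cmxXE; case: eqP => [e|_]; last by rewrite mulr0.
case/eqP: xa; apply: val_inj; rewrite /= inordK // /src_col.
by have := ltn_ord x; lia.
Qed.

(** * The projections and the minors as integer tables *)

(** On indices below 3 these are the Gram matrix of the columns of [A0], times 3,
    and their pairwise determinants, times [sqrt 3]: the three columns point to
    the vertices of an equilateral triangle, so the determinant is the cyclic
    orientation of the pair. *)
Definition gram3 (x y : nat) : int := if x == y then 2 else -1.
Definition eps (x y : nat) : int :=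
  if x == y then 0 else if (x.+1 %% 3 == y %% 3)%N then 1 else -1.

Lemma sqrt23_sq (R : realType) : Num.sqrt (2 / 3) * Num.sqrt (2 / 3) = 2 / 3 :> R.
Proof. by rewrite -expr2 sqr_sqrtr // divr_ge0 // ler0n. Qed.

(** The last column of [A0] is zero, whence the conditional. *)
Lemma A0_gram (R : realType) (x y : 'I_4) :
  \sum_r A0 R r x * A0 R r y =
  (if ((x < 3) && (y < 3))%N then gram3 x y else 0)%:~R / 3.
Proof.
have h3 := sqrt3_sq R; have h23 := sqrt23_sq R.
rewrite 2!big_ord_recr big_ord0 /= !mxE /=.
set h := Num.sqrt (2 / 3) in h23 *; set q := Num.sqrt 3 in h3 *.
(* Every term contains [h] squared, and then [q] occurs only squared too. *)
have -> (s t s' t' : R) : 0 + h * s * (h * t) + h * s' * (h * t') =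
    2 / 3 * (s * t + s' * t') by rewrite -h23; ring.
case: x => [[|[|[|[|?]]]] ?]; case: y => [[|[|[|[|?]]]] ?] //=;
rewrite /gram3 /=; nra.
Qed.

Lemma A0_det (R : realType) (x y : 'I_4) :
  A0 R 0 x * A0 R 1 y - A0 R 0 y * A0 R 1 x =
  (if ((x < 3) && (y < 3))%N then eps x y else 0)%:~R / Num.sqrt 3.
Proof.
have h3 := sqrt3_sq R; have h23 := sqrt23_sq R.
(* Clearing the denominator makes the equality polynomial in [h^2] and [q^2]. *)
apply: (mulIf (lt0r_neq0 (sqrt3_gt0 R))).
rewrite (divfK (lt0r_neq0 (sqrt3_gt0 R))) !mxE /=.
set h := Num.sqrt (2 / 3) in h23 *; set q := Num.sqrt 3 in h3 *.
have -> (s t s' t' : R) : (h * s * (h * t) - h * s' * (h * t')) * q =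
    2 / 3 * (s * (t * q) - s' * (t' * q)) by rewrite -h23; ring.
case: x => [[|[|[|[|?]]]] ?]; case: y => [[|[|[|[|?]]]] ?] //=;
rewrite /eps /=; nra.
Qed.

(** Three times [D - w w^T / 3]: the signs square to one on the diagonal. *)
Definition Pproj3 (j k a b : nat) : int :=
  gram3 a b * sign_row j k a * sign_row j k b.

Lemma src_col_eq k (a b : 'I_4) : (src_col k a == src_col k b) = (a == b).
Proof.
rewrite -(inj_eq val_inj) /src_col; have := ltn_ord a; have := ltn_ord b.
by move=> /= *; apply/eqP/eqP; lia.
Qed.

Lemma PprojE (R : realType) (j : 'I_4) k (a b : 'I_4) :
  Pproj R j k a b = (Pproj3 j k a b)%:~R / 3.
Proof.
rewrite /Pproj mxE.
under eq_bigr => r _ do rewrite mxE !AgenE mulrACA.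
rewrite -big_distrl A0_gram /= !inordK ?ltn_mod // /Pproj3 /sign_row /gram3.
rewrite src_col_eq (inj_eq val_inj).
case: (_ < 3)%N; case: (_ < 3)%N; rewrite /= ?(mulr0, mul0r) //.
by rewrite !intrM mulrAC -!mulrA.
Qed.

(** The coordinates of the Pluecker embedding are indexed by the pairs
    [edge1 i < edge2 i] in lexicographic order. *)
Definition edge1 i := nth 0%N [:: 0; 0; 0; 1; 1; 2]%N i.
Definition edge2 i := nth 0%N [:: 1; 2; 3; 2; 3; 3]%N i.

Lemma det2 (R : comPzRingType) (M : 'M[R]_2) :
  \det M = M 0 0 * M 1 1 - M 0 1 * M 1 0.
Proof.
rewrite (expand_det_row _ 0) 2!big_ord_recr big_ord0 /= add0r.
rewrite /cofactor !det_mx11 !mxE.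
have -> : widen_ord (leqnSn 1) ord_max = 0 :> 'I_2 by apply: val_inj.
have -> : ord_max = 1 :> 'I_2 by apply: val_inj.
have -> : lift 0 0 = 1 :> 'I_2 by apply: val_inj.
have -> : lift 1 0 = 0 :> 'I_2 by apply: val_inj.
by rewrite addn0 expr0 add0n expr1 mul1r mulN1r mulrN.
Qed.

Lemma plucker_minorE (R : realType) (B : 'M[R]_(2, 4)) a b :
  plucker_minor B a b =
  B 0 (inord a) * B 1 (inord b) - B 0 (inord b) * B 1 (inord a).
Proof.
rewrite /plucker_minor; set M := row_mx _ _.
have M0 r (c : 'I_2) : c = 0 :> nat -> M r c = B r (inord a).
  by move=> c0; rewrite /M (_ : c = @lshift 1 1 0) ?row_mxEl ?mxE //; apply: val_inj.
have M1 r (c : 'I_2) : c = 1%N :> nat -> M r c = B r (inord b).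
  by move=> c1; rewrite /M (_ : c = @rshift 1 1 0) ?row_mxEr ?mxE //; apply: val_inj.
by rewrite det2 !(M0 _ 0) // !(M1 _ 1) //.
Qed.

(** The signs of the two columns factor out of their determinant, which is the
    one computed from the columns of [A0] before the shift. *)
Definition pluckerZ (i j k : nat) : int :=
  let a := edge1 i in let b := edge2 i in
  eps (src_col k a) (src_col k b) * sign_row j k a * sign_row j k b.

Lemma plucker_Agen (R : realType) (i : 'I_6) (j : 'I_4) k :
  plucker (Agen R j k) i 0 = (pluckerZ i j k)%:~R / Num.sqrt 3.
Proof.
have -> : plucker (Agen R j k) i 0 =
    plucker_minor (Agen R j k) (edge1 i) (edge2 i).
  by rewrite mxE; case: i => [[|[|[|[|[|[|?]]]]]] ?].
have [e1 e2] : (edge1 i < 4)%N /\ (edge2 i < 4)%N.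
  by case: i => [[|[|[|[|[|[|?]]]]]] ?].
rewrite plucker_minorE !AgenE !inordK // mulrACA [X in _ - X]mulrACA.
rewrite [X in _ - _ * X]mulrC -mulrBl A0_det /= !inordK ?ltn_mod //.
rewrite /pluckerZ /sign_row.
case: (_ < 3)%N; case: (_ < 3)%N; rewrite /= ?(mulr0, mul0r) //.
by rewrite !intrM mulrAC -!mulrA.
Qed.

(** * The tight fusion frame *)

(** The three factors of a generator have orthonormal rows. *)
Lemma Agen_generator (R : realType) (j : 'I_4) k :
  is_generator (Pproj R j k) (Agen R j k).
Proof.
split=> //.
have A1 : A0 R *m (A0 R)^T = 1%:M.
  have h3 := sqrt3_sq R; have h23 := sqrt23_sq R.
  apply/matrixP => r s; rewrite !mxE 4!big_ord_recr big_ord0 /= !mxE /=.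
  set h := Num.sqrt (2 / 3) in h23 *; set q := Num.sqrt 3 in h3 *.
  case: r => [[|[|?]] ?] //; case: s => [[|[|?]] ?] //=; nra.
have d1 : dmx R j *m (dmx R j)^T = 1%:M.
  apply/matrixP => x y; rewrite !mxE (bigD1 x) //= big1 => [|z zx].
    rewrite addr0 mxE !dmxE eqxx eq_sym; case: eqP => [<-|_].
      case: x => [[|[|[|[|?]]]] ?] //; case: j => [[|[|[|[|?]]]] ?] //=;
        rewrite /dmx_sign /=; nra.
    by rewrite mulr0.
  by rewrite dmxE eq_sym (negbTE zx) mul0r.
have c1 : (cmx R ^+ k) *m (cmx R ^+ k)^T = 1%:M.
  apply/matrixP => x y; rewrite !mxE (bigD1 (inord ((x + k) %% 4))) //=.
  rewrite big1 => [|z].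
    rewrite addr0 mxE !cmxXE inordK ?ltn_mod // eqxx mul1r.
    congr (_ %:R); rewrite -(inj_eq val_inj) /=.
    by have := ltn_ord x; have := ltn_ord y; lia.
  rewrite -(inj_eq val_inj) /= inordK ?ltn_mod // cmxXE eq_sym => /negbTE ->.
  by rewrite mul0r.
rewrite /Agen !trmx_mul -!mulmxA (mulmxA (_ ^+ _)) c1 mul1mx.
by rewrite (mulmxA (dmx _ _)) d1 mul1mx.
Qed.

(** Sandwiching [P] between [B] and [B^T] gives the identity of size 2, which
    bounds the rank of [P] from below. *)
Lemma generator_projection (R : realType) (P : 'M[R]_4) B :
  is_generator P B -> orthogonal_projection P /\ \rank P = 2%N.
Proof.
move=> [BB ->]; split; first split.
- by rewrite mulmxA -(mulmxA B^T) BB mulmx1.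
- by rewrite trmx_mul trmxK.
apply/eqP; rewrite eqn_leq (leq_trans (mxrankM_maxr _ _) (rank_leq_row _)) /=.
have {1}<- : \rank (B *m (B^T *m B) *m B^T) = 2%N.
  by rewrite mulmxA BB mul1mx BB mxrank1.
exact: leq_trans (mxrankM_maxl _ _) (mxrankM_maxr _ _).
Qed.

Definition trace9 (j k j' k' : nat) : int :=
  isum 4 (fun a => isum 4 (fun b => Pproj3 j k a b * Pproj3 j' k' b a)).

Lemma trace_Pproj (R : realType) (j k j' k' : 'I_4) :
  \tr (Pproj R j k *m Pproj R j' k') = (trace9 j k j' k')%:~R / 9.
Proof.
rewrite /mxtrace /trace9 -isumE big_distrl /=; apply: eq_bigr => a _.
rewrite mxE -isumE big_distrl /=; apply: eq_bigr => b _.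
by rewrite !PprojE mulrACA -invfM intrM -natrM.
Qed.

(** Separates distinct indices and gives the two angles at once: the trace is 2
    exactly on the diagonal. *)
Lemma trace_Pproj_val (R : realType) (i i' : 'I_4 * 'I_4) :
  \tr (Pproj R i.1 i.2 *m Pproj R i'.1 i'.2) =
  if i == i' then 2 else
  if trace9 i.1 i.2 i'.1 i'.2 == 10 then 10 / 9 else 2 / 3.
Proof.
have chk : all (fun j => all (fun k => all (fun j' => all (fun k' =>
    let t := trace9 j k j' k' in
    if (j == j') && (k == k') then t == 18 else (t == 10) || (t == 6))
    (iota 0 4)) (iota 0 4)) (iota 0 4)) (iota 0 4) by vm_compute.
case: i => j k; case: i' => j' k' /=; rewrite trace_Pproj xpair_eqE.
move: chk => /all_ord/(_ j)/all_ord/(_ k)/all_ord/(_ j')/all_ord/(_ k') /=.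
rewrite !(inj_eq val_inj); case: ifP => _; first by move=> /eqP ->; lra.
by case/orP => /eqP -> /=; lra.
Qed.

Lemma Pproj_sum (R : realType) :
  \sum_(i : 'I_4 * 'I_4) Pproj R i.1 i.2 = 8%:M.
Proof.
have chk : all (fun a => all (fun b =>
    isum 4 (fun j => isum 4 (fun k => Pproj3 j k a b)) ==
    if a == b then 24 else 0) (iota 0 4)) (iota 0 4) by vm_compute.
apply/matrixP => a b; rewrite summxE.
rewrite -(pair_bigA _ (fun j k : 'I_4 => Pproj R j k a b)) /=.
transitivity ((isum 4 (fun j => isum 4 (fun k => Pproj3 j k a b)))%:~R / 3 : R).
  rewrite -isumE big_distrl; apply: eq_bigr => j _ /=.
  by rewrite -isumE big_distrl; apply: eq_bigr => k _; rewrite PprojE.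
rewrite (eqP (all2_ord chk a b)) mxE (inj_eq val_inj).
by case: eqP => _ /=; lra.
Qed.

Lemma Pproj_angles (R : realType) :
  chordal_angle_set (fun i : 'I_4 * 'I_4 => Pproj R i.1 i.2) =
  [set Num.sqrt (10 / 9); Num.sqrt (2 / 3)].
Proof.
apply/seteqP; split=> t /=.
  case=> i [i' [ii' ->]]; rewrite trace_Pproj_val (negbTE ii').
  by case: ifP => _; [left|right].
case=> ->.
(* For [k = k' = 0] two distinct sign patterns have inner product [+-1]. *)
- by exists (0, 0), (1, 0); split=> //; rewrite trace_Pproj_val.
(* (1,1,1,0) and (0,1,-1,1) are orthogonal. *)
- exists (0, 0), (@Ordinal 4 2 isT, 1); split=> //.
  by rewrite trace_Pproj_val.
Qed.

(** * The Steiner structure *)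

(** The three edges avoiding the vertex at which the vectors of block [k] have
    their zero column: the support of that block. *)
Definition ones (k : nat) : seq nat :=
  [seq i <- iota 0 6 | ((src_col k (edge1 i) < 3) && (src_col k (edge2 i) < 3))%N].

Definition synthZ (i t : nat) : int := pluckerZ i (t %% 4) (t %/ 4).

Lemma synth_etf (R : realType) : etf (scaled_mx R 6 16 synthZ).
Proof. by apply: (@etf_scaled R 6 16 synthZ 8); [| | vm_compute | vm_compute]. Qed.

(** Block [k] of the synthesis matrix with its zero rows removed, the others
    being kept in order. *)
Definition flatZ (k r j : nat) : int := pluckerZ (nth 0%N (ones k) r) j k.

Lemma flat_etf (R : realType) (k : 'I_4) : etf (scaled_mx R 3 4 (flatZ k)).
Proof.
by apply: (@etf_scaled R 3 4 _ 4) => [| | |];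
  case: k => [[|[|[|[|?]]]] ?] //; vm_compute.
Qed.

Lemma flat_flat (R : realType) (k : 'I_4) : flat (scaled_mx R 3 4 (flatZ k)).
Proof.
have chk : all (fun k => all (fun r => all (fun j => `|flatZ k r j| == 1)
  (iota 0 4)) (iota 0 3)) (iota 0 4) by vm_compute.
move=> r j; rewrite mxE normrM normfV -intr_norm.
move: chk => /all_ord/(_ k)/all_ord/(_ r)/all_ord/(_ j)/eqP ->.
by rewrite [`|Num.sqrt _|]ger0_norm ?sqrtr_ge0.
Qed.

(** Edge-triangle incidence in the complete graph on four points. *)
Definition steinerS : 'M[nat]_(6, 4) :=
  \matrix_(i < 6, k < 4) ((i : nat) \in ones k : nat).

Lemma steinerS_steiner : steiner_matrix 2 3 steinerS.
Proof.
split=> //.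
- by move=> i j; rewrite mxE; case: (_ \in _); [right|left].
- split=> [i|j].
    rewrite 4!big_ord_recr big_ord0 /= !mxE /=.
    by case: i => [[|[|[|[|[|[|?]]]]]] ?].
  rewrite 6!big_ord_recr big_ord0 /= !mxE /=.
  by case: j => [[|[|[|[|?]]]] ?].
- move=> j j'; rewrite -(inj_eq val_inj) 6!big_ord_recr big_ord0 /= !mxE /=.
  by case: j => [[|[|[|[|?]]]] ?] //; case: j' => [[|[|[|[|?]]]] ?].
Qed.

Definition Fblock (R : realType) (k : nat) : 'M[R]_(6, 4) :=
  scaled_mx R 6 4 (fun i j => pluckerZ i j k).

Lemma Fblock_steiner (R : realType) (k : 'I_4) :
  steiner_block steinerS k (scaled_mx R 3 4 (flatZ k)) (Fblock R k).
Proof.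
have idx3 i : i \in ones k -> (index i (ones k) < 3)%N.
  by rewrite -index_mem; case: k => [[|[|[|[|?]]]] ?].
(* Each edge of the triangle receives the row of its rank among the three. *)
exists (fun i => inord (index (i : nat) (ones k))); split=> [i i'|i].
  rewrite !mxE; case: (boolP (_ \in _)) => // hi _.
  case: (boolP (_ \in _)) => // hi' _ /(congr1 val) /=.
  rewrite !inordK ?idx3 // => e; apply: val_inj.
  by rewrite /= -(nth_index 0%N hi) e nth_index.
apply/rowP => j; rewrite !mxE; case: (boolP (_ \in _)) => hi /=.
  by rewrite !mxE /flatZ inordK ?idx3 // nth_index.
rewrite mxE.
suff -> : pluckerZ i j k = 0 by rewrite mul0r.
move: hi; rewrite mem_filter mem_iota leq0n add0n ltn_ord !andbT negb_and.
rewrite /pluckerZ /sign_row.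
by case/orP => /negbTE ->; rewrite ?mulr0 ?mul0r.
Qed.

(** The vectors come in four blocks of four, the column [t = 4 k + j] being the
    [j]-th one of block [k]. *)
Lemma synth_steiner (R : realType) : steiner_etf (scaled_mx R 6 16 synthZ).
Proof.
split; first exact: synth_etf.
have en : (\sum_(j < 4) 4)%N = 16%N by rewrite sum_nat_const card_ord.
exists 4%N, 2%N, 3%N, steinerS, (fun k : 'I_4 => scaled_mx R 3 4 (flatZ k)),
  (fun k : 'I_4 => Fblock R k), en; split.
- exact: steinerS_steiner.
- by move=> k; split; [exact: flat_etf | exact: flat_flat].
- exact: Fblock_steiner.
apply: (canRL (castmxKV _ _)); apply/mxrowP => k; rewrite mxrowK.
have rankE (j : 'I_4) : @tagnat.Rank 4 (fun=> 4%N) k j = (k * 4 + j)%N :> nat.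
  rewrite tagnat.RankEsum.
  by case: k => [[|[|[|[|?]]]] ?] //; rewrite big_mkcond 4!big_ord_recr big_ord0.
apply/matrixP => i j; rewrite mxE castmxE !mxE cast_ord_id /synthZ.
set t := cast_ord _ _; have -> : t = (k * 4 + j)%N :> nat by exact: rankE.
by rewrite modnMDl modn_small // divnMDl // divn_small // addn0.
Qed.

(* Column t of the synthesis matrix in (b) is the Plucker vector with
   j = t mod 4 and k = t div 4. *)
Theorem mainTheorem7 (R : realType) :
  (let P := fun jk : 'I_4 * 'I_4 => Pproj R jk.1 jk.2 in
   [/\ tight_fusion_frame 16 2 P,
       chordally_biangular P
     & chordal_angle_set P = [set Num.sqrt (10 / 9); Num.sqrt (2 / 3)]]) /\
  ((forall j k : 'I_4, is_generator (Pproj R j k) (Agen R j k)) /\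
   steiner_etf
     (\matrix_(i < 6, t < 16) plucker (Agen R (t %% 4) (t %/ 4)) i 0)).
Proof.
split=> /=.
  split; last exact: Pproj_angles.
    split.
    - by rewrite card_prod card_ord.
    - move=> i i' e; apply/eqP; apply: contraT => ii'.
      have := trace_Pproj_val R i i; have := trace_Pproj_val R i i'.
      rewrite -e (negbTE ii') eqxx => ->.
      by case: ifP => _; lra.
    - by move=> i; apply: generator_projection (Agen_generator _ _ _).
    - by exists 8; [rewrite ltr0n | exact: Pproj_sum].
  exists (Num.sqrt (10 / 9)), (Num.sqrt (2 / 3)); split; last exact: Pproj_angles.
  by rewrite gt_eqF // ltr_sqrt; lra.
split; first by move=> j k; exact: Agen_generator.
set M := (X in steiner_etf X).
suff -> : M = scaled_mx R 6 16 synthZ by exact: synth_steiner.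
apply/matrixP => i t; rewrite !mxE /synthZ.
have t4 : (t %% 4 < 4)%N by rewrite ltn_mod.
by rewrite -(plucker_Agen _ i (Ordinal t4)) mxE.
Qed.
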